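(* Let $a>b>0$ and consider the family of Poncelet triangles of the confocal pair with outer ellipse of semi-axes $a,b$. Let $\delta=\sqrt{a^4-a^2b^2+b^4}$, let $\alpha,\beta\in\mathbb{R}$ with $\beta\neq0$, and let $\mathcal{X}=\alpha X_2+\beta X_3$. The locus of $\mathcal{X}$ over the family is a circle when $\alpha/\beta$ equals one of the two values $$\left(\frac{\alpha}{\beta}\right)_{\pm}=\frac{-3ab\pm\left(\delta+2(a^2+b^2)\right)}{2ab}.$$
   Context: Confocal pair: the outer ellipse is $\frac{x^2}{a^2}+\frac{y^2}{b^2}=1$ with $a>b>0$; put $c^2=a^2-b^2$ and $\delta=\sqrt{a^4-a^2b^2+b^4}$. The inner ellipse (caustic) is the ellipse confocal with it having semi-axes $a_c=a(\delta-b^2)/c^2$ along the $x$-axis and $b_c=b(a^2-\delta)/c^2$ along the $y$-axis. This is the confocal ellipse for which triangles exist that are inscribed in the outer ellipse and have all side lines tangent to the inner one; these are the Poncelet triangles, and every point of the outer ellipse is a vertex of exactly one of them. $X_2$ is the barycenter (centroid) and $X_3$ the circumcenter of a triangle, regarded as vectors in the plane with origin at the common center of the ellipses. The locus of $\mathcal{X}$ is the set of its positions over all triangles of the family. *)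

(* Defs.v *)
From Stdlib Require Import Reals.
Open Scope R_scope.

Definition point : Type := (R * R)%type.

Definition padd (P Q : point) : point := (fst P + fst Q, snd P + snd Q).
Definition pscal (t : R) (P : point) : point := (t * fst P, t * snd P).

Definition pdist (P Q : point) : R := dist_euc (fst P) (snd P) (fst Q) (snd Q).

Definition line (P Q X : point) : Prop :=
  exists t : R, X = padd (pscal (1 - t) P) (pscal t Q).

Definition collinear (P Q S : point) : Prop :=
  exists A B : point, A <> B /\ line A B P /\ line A B Q /\ line A B S.

Definition on_ellipse (p q : R) (X : point) : Prop :=
  (fst X) ^ 2 / p ^ 2 + (snd X) ^ 2 / q ^ 2 = 1.

(* The line through [T] orthogonal to the gradient at [T] of
   [x^2 / p^2 + y^2 / q^2], up to a factor 2. *)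
Definition tangent_at (p q : R) (T X : point) : Prop :=
  fst T / p ^ 2 * (fst X - fst T) + snd T / q ^ 2 * (snd X - snd T) = 0.

Definition side_tangent (p q : R) (P Q : point) : Prop :=
  exists T : point,
    on_ellipse p q T /\ forall X : point, line P Q X <-> tangent_at p q T X.

Definition delta (a b : R) : R := sqrt (a ^ 4 - a ^ 2 * b ^ 2 + b ^ 4).

Definition caustic_a (a b : R) : R :=
  a * (delta a b - b ^ 2) / (a ^ 2 - b ^ 2).
Definition caustic_b (a b : R) : R :=
  b * (a ^ 2 - delta a b) / (a ^ 2 - b ^ 2).

Definition poncelet_triangle (a b : R) (P Q S : point) : Prop :=
  ~ collinear P Q S /\
  on_ellipse a b P /\ on_ellipse a b Q /\ on_ellipse a b S /\
  side_tangent (caustic_a a b) (caustic_b a b) P Q /\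
  side_tangent (caustic_a a b) (caustic_b a b) Q S /\
  side_tangent (caustic_a a b) (caustic_b a b) S P.

Definition centroid (P Q S : point) : point :=
  pscal (1 / 3) (padd (padd P Q) S).

(* For non-collinear [P], [Q], [S] there is exactly one such [O]. *)
Definition is_circumcenter (P Q S O : point) : Prop :=
  pdist O P = pdist O Q /\ pdist O Q = pdist O S.

Definition locus (a b alpha beta : R) (X : point) : Prop :=
  exists P Q S O : point,
    poncelet_triangle a b P Q S /\
    is_circumcenter P Q S O /\
    X = padd (pscal alpha (centroid P Q S)) (pscal beta O).

Definition is_circle (L : point -> Prop) : Prop :=
  exists (M : point) (r : R), 0 < r /\ forall X : point, L X <-> pdist X M = r.

(* Main.v *)
(** Scale the outer ellipse to the unit circle, write its points as complex
    numbers, and let [p = caustic_a / a], [q = caustic_b / b], so [p + q = 1].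
    A chord [z1 z2] is tangent to the caustic exactly when
    [x1 x2 / p + y1 y2 / q = -1], so the two vertices other than [z1] are the
    intersections of the circle with a line depending on [z1]; this chord is then
    itself tangent. Solving for them gives [z1 + z2 + z3 = - (p - q) l] with
    [l = z1 z2 z3], and the circumcenter [O] of the unscaled triangle is
    [(c^2 q / (2 a) Re l, c^2 p / (2 b) Im l)], with [c^2 = a^2 - b^2].
    Hence [alpha X2 + beta X3 = (A Re l, B Im l)] with constants [A] and [B]; every
    [l] on the unit circle occurs, and the two given ratios are those making
    [A = - B] or [A = B]. *)
Require Import Defs.
From Stdlib Require Import Reals Lra Nsatz.
Open Scope R_scope.

(* [nsatz] treats [x ^ n] in [R] as an atom. *)
Ltac nsatz_pow := cbn [pow] in *; nsatz.

(** * Chords of the unit circle *)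

Lemma Rdiv_eq_iff (x y z : R) : y <> 0 -> (x / y = z <-> x = z * y).
Proof.
  intros hy; split; intros h.
  - rewrite <- h; field; exact hy.
  - rewrite h; field; exact hy.
Qed.

Lemma sum_squares_zero (x y : R) : x ^ 2 + y ^ 2 = 0 -> x = 0 /\ y = 0.
Proof. intros h; split; nra. Qed.

(** Vieta's formulas for the two points where the line [u x + v y = w] meets the circle, multiplied
    by [u ^ 2 + v ^ 2] to avoid division. *)
Lemma chord_of_unit_circle (u v w x1 y1 x2 y2 : R) :
  x1 ^ 2 + y1 ^ 2 = 1 -> x2 ^ 2 + y2 ^ 2 = 1 ->
  (x1 - x2) ^ 2 + (y1 - y2) ^ 2 <> 0 ->
  u * x1 + v * y1 = w -> u * x2 + v * y2 = w ->
  (u ^ 2 + v ^ 2) * (x1 + x2) = 2 * u * w /\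
  (u ^ 2 + v ^ 2) * (y1 + y2) = 2 * v * w /\
  (u ^ 2 + v ^ 2) * (x1 * x2) = w ^ 2 - v ^ 2 /\
  (u ^ 2 + v ^ 2) * (y1 * y2) = w ^ 2 - u ^ 2 /\
  (u ^ 2 + v ^ 2) * (x1 * y2 + x2 * y1) = 2 * u * v.
Proof.
  intros h1 h2 hd e1 e2.
  (* Both [(u, v)] and [(x1 + x2, y1 + y2)] are orthogonal to the chord, whose direction is nonzero
     by [hd]; hence they are parallel. *)
  assert (hperp : u * (y1 + y2) = v * (x1 + x2)).
  { apply Rmult_eq_reg_r with (2 := hd), Rminus_diag_uniq.
    assert (hs : (x1 + x2) * (x1 - x2) + (y1 + y2) * (y1 - y2) = 0) by lra.
    assert (hw : u * (x1 - x2) + v * (y1 - y2) = 0) by lra.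
    transitivity
      (((y1 + y2) * (x1 - x2) - (x1 + x2) * (y1 - y2))
         * (u * (x1 - x2) + v * (y1 - y2))
       + (u * (y1 - y2) - v * (x1 - x2))
         * ((x1 + x2) * (x1 - x2) + (y1 + y2) * (y1 - y2))); [ring|].
    rewrite hs, hw; ring. }
  clear hd.
  assert (hx : (u ^ 2 + v ^ 2) * (x1 + x2) = 2 * u * w) by nsatz_pow.
  assert (hy : (u ^ 2 + v ^ 2) * (y1 + y2) = 2 * v * w) by nsatz_pow.
  repeat split; try assumption; nsatz_pow.
Qed.

(** * Products of three points of the circle, and conjugate points *)

(* The real and imaginary parts of [z1 * z2 * z3], where [zj = xj + i yj]. *)
Definition re3 (x1 y1 x2 y2 x3 y3 : R) : R :=
  x1 * x2 * x3 - x1 * y2 * y3 - y1 * x2 * y3 - y1 * y2 * x3.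
Definition im3 (x1 y1 x2 y2 x3 y3 : R) : R :=
  y1 * x2 * x3 + x1 * y2 * x3 + x1 * x2 * y3 - y1 * y2 * y3.

Lemma re3_im3_unit (x1 y1 x2 y2 x3 y3 : R) :
  x1 ^ 2 + y1 ^ 2 = 1 -> x2 ^ 2 + y2 ^ 2 = 1 -> x3 ^ 2 + y3 ^ 2 = 1 ->
  re3 x1 y1 x2 y2 x3 y3 ^ 2 + im3 x1 y1 x2 y2 x3 y3 ^ 2 = 1.
Proof.
  intros h1 h2 h3; unfold re3, im3.
  transitivity ((x1 ^ 2 + y1 ^ 2) * (x2 ^ 2 + y2 ^ 2) * (x3 ^ 2 + y3 ^ 2)).
  - ring.
  - rewrite h1, h2, h3; ring.
Qed.

(* For [p + q = 1], the chord of the unit circle through two conjugate points is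
   tangent to the ellipse with semi-axes [p] and [q]; the condition is bilinear
   because of [p + q = 1]. *)
Definition conjugate (p q x1 y1 x2 y2 : R) : Prop :=
  q * x1 * x2 + p * y1 * y2 = - (p * q).

Lemma weighted_squares_pos (A B x y : R) :
  0 < A -> 0 < B -> x ^ 2 + y ^ 2 = 1 -> 0 < A * x ^ 2 + B * y ^ 2.
Proof. intros hA hB h; destruct (Rle_lt_dec A B); nra. Qed.

(** [(q x, p y)] is normal to the line of points conjugate to [(x, y)]; its squared length is
    divided out below. *)
Lemma polar_normal_pos (p q x y : R) :
  0 < p -> 0 < q -> x ^ 2 + y ^ 2 = 1 -> 0 < (q * x) ^ 2 + (p * y) ^ 2.
Proof.
  intros hp hq h; rewrite !Rpow_mult_distr.
  apply weighted_squares_pos; trivial; nra.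
Qed.

(** Let [n = q x1 + i p y1], normal to the chord [z2 z3]. The chord formulas give
    [|n|^2 z2 z3 = n^2], and the right-hand sides are the two parts of [z1 n^2]. *)
Lemma product_of_conjugates (p q x1 y1 x2 y2 x3 y3 : R) :
  p + q = 1 ->
  x1 ^ 2 + y1 ^ 2 = 1 -> x2 ^ 2 + y2 ^ 2 = 1 -> x3 ^ 2 + y3 ^ 2 = 1 ->
  (x2 - x3) ^ 2 + (y2 - y3) ^ 2 <> 0 ->
  conjugate p q x1 y1 x2 y2 -> conjugate p q x1 y1 x3 y3 ->
  ((q * x1) ^ 2 + (p * y1) ^ 2) * re3 x1 y1 x2 y2 x3 y3 =
    x1 * ((q * x1) ^ 2 - (p * y1) ^ 2) - y1 * (2 * (q * x1) * (p * y1)) /\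
  ((q * x1) ^ 2 + (p * y1) ^ 2) * im3 x1 y1 x2 y2 x3 y3 =
    y1 * ((q * x1) ^ 2 - (p * y1) ^ 2) + x1 * (2 * (q * x1) * (p * y1)).
Proof.
  intros hpq h1 h2 h3 hd e2 e3; unfold conjugate in *.
  destruct (chord_of_unit_circle (q * x1) (p * y1) (- (p * q)) x2 y2 x3 y3 h2 h3 hd
              ltac:(lra) ltac:(lra)) as (_ & _ & hxx & hyy & hxy).
  split; unfold re3, im3.
  - transitivity
      (x1 * (((q * x1) ^ 2 + (p * y1) ^ 2) * (x2 * x3)
             - ((q * x1) ^ 2 + (p * y1) ^ 2) * (y2 * y3))
       - y1 * (((q * x1) ^ 2 + (p * y1) ^ 2) * (x2 * y3 + x3 * y2))); [ring|].
    rewrite hxx, hyy, hxy; ring.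
  - transitivity
      (y1 * (((q * x1) ^ 2 + (p * y1) ^ 2) * (x2 * x3)
             - ((q * x1) ^ 2 + (p * y1) ^ 2) * (y2 * y3))
       + x1 * (((q * x1) ^ 2 + (p * y1) ^ 2) * (x2 * y3 + x3 * y2))); [ring|].
    rewrite hxx, hyy, hxy; ring.
Qed.

(** For the same [n], [|n|^2 (z2 + z3) = - 2 p q n] and [|n|^2 l = z1 n^2], so the claim times
    [|n|^2] is an identity in [z1] on the circle. *)
Lemma sum_of_conjugates (p q x1 y1 x2 y2 x3 y3 : R) :
  0 < p -> 0 < q -> p + q = 1 ->
  x1 ^ 2 + y1 ^ 2 = 1 -> x2 ^ 2 + y2 ^ 2 = 1 -> x3 ^ 2 + y3 ^ 2 = 1 ->
  (x2 - x3) ^ 2 + (y2 - y3) ^ 2 <> 0 ->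
  conjugate p q x1 y1 x2 y2 -> conjugate p q x1 y1 x3 y3 ->
  x1 + x2 + x3 = - (p - q) * re3 x1 y1 x2 y2 x3 y3 /\
  y1 + y2 + y3 = - (p - q) * im3 x1 y1 x2 y2 x3 y3.
Proof.
  intros hp hq hpq h1 h2 h3 hd e2 e3.
  pose proof (polar_normal_pos p q x1 y1 hp hq h1) as hN.
  destruct (product_of_conjugates p q x1 y1 x2 y2 x3 y3 hpq h1 h2 h3 hd e2 e3)
    as (hre & him).
  unfold conjugate in e2, e3.
  destruct (chord_of_unit_circle (q * x1) (p * y1) (- (p * q)) x2 y2 x3 y3 h2 h3 hd
              ltac:(lra) ltac:(lra)) as (hx & hy & _).
  set (N := (q * x1) ^ 2 + (p * y1) ^ 2) in *.
  assert (hN0 : N <> 0) by lra.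
  split; apply Rmult_eq_reg_l with (2 := hN0).
  - transitivity (N * x1 + N * (x2 + x3)); [ring|].
    transitivity (- (p - q) * (N * re3 x1 y1 x2 y2 x3 y3)); [|ring].
    rewrite hx, hre; unfold N. clear - hpq h1. replace q with (1 - p) by lra. nsatz_pow.
  - transitivity (N * y1 + N * (y2 + y3)); [ring|].
    transitivity (- (p - q) * (N * im3 x1 y1 x2 y2 x3 y3)); [|ring].
    rewrite hy, him; unfold N. clear - hpq h1. replace q with (1 - p) by lra. nsatz_pow.
Qed.

(** The normal [(q x1, p y1)] is orthogonal to [z2 - z3] but has a positive product with [z1 - z2],
    so these two differences are not parallel. *)
Lemma conjugates_not_aligned (p q x1 y1 x2 y2 x3 y3 : R) :
  0 < p -> 0 < q ->
  x1 ^ 2 + y1 ^ 2 = 1 ->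
  (x2 - x3) ^ 2 + (y2 - y3) ^ 2 <> 0 ->
  conjugate p q x1 y1 x2 y2 -> conjugate p q x1 y1 x3 y3 ->
  (x1 - x2) * (y2 - y3) - (y1 - y2) * (x2 - x3) <> 0.
Proof.
  intros hp hq h1 hd e2 e3 hdet; unfold conjugate in *.
  (* [q x1 (x1 - x2) + p y1 (y1 - y2) = q x1^2 + p y1^2 + p q], by [e2] *)
  assert (hpos : 0 < q * x1 * (x1 - x2) + p * y1 * (y1 - y2)).
  { assert (0 < p * q) by nra. assert (0 <= q * x1 ^ 2) by nra.
    assert (0 <= p * y1 ^ 2) by nra. nra. }
  apply hd.
  apply Rmult_eq_reg_l with (r := q * x1 * (x1 - x2) + p * y1 * (y1 - y2)); [|lra].
  rewrite Rmult_0_r.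
  assert (h : q * x1 * (x2 - x3) + p * y1 * (y2 - y3) = 0) by lra.
  clear - h hdet. nsatz_pow.
Qed.

(** The last conjugacy is the closure of the Poncelet triangle: the chord cut out by the first two
    is tangent as well. *)
Lemma conjugates_exist (p q x y : R) :
  0 < p -> 0 < q -> p + q = 1 -> x ^ 2 + y ^ 2 = 1 ->
  exists x2 y2 x3 y3 : R,
    x2 ^ 2 + y2 ^ 2 = 1 /\ x3 ^ 2 + y3 ^ 2 = 1 /\
    (x2 - x3) ^ 2 + (y2 - y3) ^ 2 <> 0 /\
    conjugate p q x y x2 y2 /\ conjugate p q x y x3 y3 /\
    conjugate p q x2 y2 x3 y3.
Proof.
  intros hp hq hpq h.
  pose proof (polar_normal_pos p q x y hp hq h) as hN.
  set (u := q * x) in *. set (v := p * y) in *.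
  set (N := u ^ 2 + v ^ 2) in *.
  (* The line lies at distance [p q / sqrt N] from the center, so this says that it cuts the circle
     twice; it holds because [p, q < 1]. *)
  assert (hD : 0 < N - (p * q) ^ 2).
  { assert (h0 : 0 < p * q) by nra.
    assert (hqp : p * q < q) by nra. assert (hpp : p * q < p) by nra.
    assert (hq1 : (p * q) ^ 2 < q ^ 2) by nra.
    assert (hp1 : (p * q) ^ 2 < p ^ 2) by nra.
    replace (N - (p * q) ^ 2) with (N - (p * q) ^ 2 * (x ^ 2 + y ^ 2))
      by (rewrite h; ring).
    replace (_ - _)
      with ((q ^ 2 - (p * q) ^ 2) * x ^ 2 + (p ^ 2 - (p * q) ^ 2) * y ^ 2)
      by (unfold N, u, v; ring).
    apply weighted_squares_pos; lra. }
  set (k := sqrt (N - (p * q) ^ 2)).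
  assert (hk : k ^ 2 = N - (p * q) ^ 2) by (apply pow2_sqrt; lra).
  assert (hk0 : 0 < k) by (apply sqrt_lt_R0; lra).
  assert (hN0 : N <> 0) by lra.
  (* The foot of the perpendicular from the center, shifted both ways along the line by [k / N]
     times the rotated normal [(- v, u)]. *)
  exists ((- (p * q) * u - k * v) / N), ((- (p * q) * v + k * u) / N).
  exists ((- (p * q) * u + k * v) / N), ((- (p * q) * v - k * u) / N).
  assert (hex : (- (p * q) * u - k * v) ^ 2 + (- (p * q) * v + k * u) ^ 2 = N * N).
  { transitivity (N * ((p * q) ^ 2 + k ^ 2)); [unfold N; ring|rewrite hk; ring]. }
  assert (hex' : (- (p * q) * u + k * v) ^ 2 + (- (p * q) * v - k * u) ^ 2 = N * N).
  { transitivity (N * ((p * q) ^ 2 + k ^ 2)); [unfold N; ring|rewrite hk; ring]. }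
  unfold conjugate.
  assert (hu2 : u * u + v * v = N) by (unfold N; ring).
  assert (hx : q * x = u) by reflexivity.
  assert (hy : p * y = v) by reflexivity.
  repeat split.
  - transitivity (((- (p * q) * u - k * v) ^ 2 + (- (p * q) * v + k * u) ^ 2) / (N * N)).
    + field; exact hN0.
    + rewrite hex; field; exact hN0.
  - transitivity (((- (p * q) * u + k * v) ^ 2 + (- (p * q) * v - k * u) ^ 2) / (N * N)).
    + field; exact hN0.
    + rewrite hex'; field; exact hN0.
  - replace (_ + _) with (4 * k ^ 2 * (u * u + v * v) / (N * N)) by (field; exact hN0).
    rewrite hu2. replace (4 * k ^ 2 * N / (N * N)) with (4 * k ^ 2 / N) by (field; exact hN0).
    assert (0 < 4 * k ^ 2 / N); [|lra].
    apply Rdiv_lt_0_compat; nra.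
  - rewrite hx, hy.
    transitivity (- (p * q) * (u * u + v * v) / N); [field; exact hN0|].
    rewrite hu2; field; exact hN0.
  - rewrite hx, hy.
    transitivity (- (p * q) * (u * u + v * v) / N); [field; exact hN0|].
    rewrite hu2; field; exact hN0.
  - transitivity
      ((q * (((p * q) * u) ^ 2 - k ^ 2 * v ^ 2) + p * (((p * q) * v) ^ 2 - k ^ 2 * u ^ 2))
         / (N * N)); [field; exact hN0|].
    apply Rdiv_eq_iff; [nra|]. rewrite hk.
    unfold N, u, v. clear - hpq h. replace q with (1 - p) by lra. nsatz_pow.
Qed.

(** * Triangles with a prescribed product of vertices *)

Lemma unit_circle_angle (x y : R) :
  x ^ 2 + y ^ 2 = 1 -> exists t : R, x = cos t /\ y = sin t.
Proof.
  intros h.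
  assert (hx : -1 <= x <= 1) by (split; nra).
  assert (hs : sin (acos x) ^ 2 = y ^ 2).
  { pose proof (sin2_cos2 (acos x)) as e. rewrite cos_acos in e by exact hx.
    unfold Rsqr in e. lra. }
  assert (hy : (sin (acos x) - y) * (sin (acos x) + y) = 0) by lra.
  apply Rmult_integral in hy; destruct hy as [hy|hy].
  - exists (acos x). rewrite cos_acos by exact hx. split; lra.
  - exists (- acos x). rewrite cos_neg, sin_neg, cos_acos by exact hx. split; lra.
Qed.

(* With [z = x + i y], [l = c + i s] and [f = p - q], this solves
   [l * (conj z - f * z) = z ^ 2 - f] on the unit circle. For [z = exp (2 i t)]
   and [l = exp (2 i r)] the difference of the two sides is
   [2 i exp (i (t + r)) * (sin (3 t - r) + f sin (t + r))], and its real factor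
   changes sign between [t = 0] and [t = PI]. *)
Lemma vertex_exists (p q c s : R) :
  0 < p -> 0 < q -> p + q = 1 -> c ^ 2 + s ^ 2 = 1 ->
  exists x y : R,
    x ^ 2 + y ^ 2 = 1 /\
    c * (2 * q * x) + s * (2 * p * y) = x ^ 2 - y ^ 2 - (p - q) /\
    s * (2 * q * x) - c * (2 * p * y) = 2 * x * y.
Proof.
  intros hp hq hpq h.
  destruct (unit_circle_angle c s h) as (th & -> & ->).
  set (r := th / 2). replace th with (2 * r) by (unfold r; field).
  set (g := fun t => sin (3 * t - r) + (p - q) * sin (t + r)).
  assert (hg : continuity g) by (unfold g; reg).
  assert (hPI : g PI = - g 0).
  { unfold g.
    replace (3 * PI - r) with (- r + PI + 2 * INR 1 * PI) by (simpl; ring).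
    rewrite sin_period, neg_sin.
    replace (PI + r) with (r + PI) by ring. rewrite neg_sin.
    rewrite Rmult_0_r, Rplus_0_l, Rminus_0_l. ring. }
  destruct (IVT_cor g 0 PI hg) as (t & _ & ht).
  { left; exact PI_RGT_0. }
  { rewrite hPI. nra. }
  exists (cos (2 * t)), (sin (2 * t)).
  pose proof (sin2_cos2 (2 * t)) as h2t; unfold Rsqr in h2t.
  (* As [A + B = 4 t], [B - A = 2 r - 2 t] and [2 B = 2 r + 2 t], every product in the goal becomes
     a polynomial in the sines and cosines of [A] and [B]. *)
  set (A := 3 * t - r). set (B := t + r).
  assert (hAB : sin A = - (p - q) * sin B) by (unfold A, B, g in *; lra).
  pose proof (sin2_cos2 B) as hB; unfold Rsqr in hB.
  assert (e1 : cos (2 * t) * cos (2 * t) - sin (2 * t) * sin (2 * t)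
               = cos A * cos B - sin A * sin B).
  { rewrite <- cos_plus, <- cos_plus; f_equal; unfold A, B; ring. }
  assert (e2 : sin (2 * t) * cos (2 * t) + cos (2 * t) * sin (2 * t)
               = sin A * cos B + cos A * sin B).
  { rewrite <- sin_plus, <- sin_plus; f_equal; unfold A, B; ring. }
  assert (e3 : cos (2 * r) * cos (2 * t) + sin (2 * r) * sin (2 * t)
               = cos B * cos A + sin B * sin A).
  { rewrite <- cos_minus, <- cos_minus; f_equal; unfold A, B; ring. }
  assert (e4 : sin (2 * r) * cos (2 * t) - cos (2 * r) * sin (2 * t)
               = sin B * cos A - cos B * sin A).
  { rewrite <- sin_minus, <- sin_minus; f_equal; unfold A, B; ring. }
  assert (e5 : cos (2 * r) * cos (2 * t) - sin (2 * r) * sin (2 * t)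
               = cos B * cos B - sin B * sin B).
  { rewrite <- cos_plus, <- cos_plus; f_equal; unfold B; ring. }
  assert (e6 : sin (2 * r) * cos (2 * t) + cos (2 * r) * sin (2 * t)
               = sin B * cos B + cos B * sin B).
  { rewrite <- sin_plus, <- sin_plus; f_equal; unfold B; ring. }
  rewrite hAB in e1, e2, e3, e4.
  clearbody A B. clear - hpq h2t hB e1 e2 e3 e4 e5 e6.
  replace q with (1 - p) in * by lra.
  repeat split; nsatz_pow.
Qed.

(** With [n = q x + i p y], the equation of [vertex_exists] reads [l * conj n = z n]; times [n] it
    is the formula of [product_of_conjugates]. *)
Lemma triangle_exists (p q c s : R) :
  0 < p -> 0 < q -> p + q = 1 -> c ^ 2 + s ^ 2 = 1 ->
  exists x1 y1 x2 y2 x3 y3 : R,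
    x1 ^ 2 + y1 ^ 2 = 1 /\ x2 ^ 2 + y2 ^ 2 = 1 /\ x3 ^ 2 + y3 ^ 2 = 1 /\
    (x2 - x3) ^ 2 + (y2 - y3) ^ 2 <> 0 /\
    conjugate p q x1 y1 x2 y2 /\ conjugate p q x1 y1 x3 y3 /\
    conjugate p q x2 y2 x3 y3 /\
    re3 x1 y1 x2 y2 x3 y3 = c /\ im3 x1 y1 x2 y2 x3 y3 = s.
Proof.
  intros hp hq hpq h.
  destruct (vertex_exists p q c s hp hq hpq h) as (x & y & h1 & e1 & e2).
  destruct (conjugates_exist p q x y hp hq hpq h1)
    as (x2 & y2 & x3 & y3 & h2 & h3 & hd & c2 & c3 & c23).
  exists x, y, x2, y2, x3, y3.
  destruct (product_of_conjugates p q x y x2 y2 x3 y3 hpq h1 h2 h3 hd c2 c3)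
    as (hre & him).
  pose proof (polar_normal_pos p q x y hp hq h1) as hN.
  assert (hN0 : (q * x) ^ 2 + (p * y) ^ 2 <> 0) by lra.
  repeat split; trivial; apply Rmult_eq_reg_l with (2 := hN0).
  - rewrite hre. clear - hpq h1 e1 e2. replace q with (1 - p) in * by lra. nsatz_pow.
  - rewrite him. clear - hpq h1 e1 e2. replace q with (1 - p) in * by lra. nsatz_pow.
Qed.

(** * Tangency to the caustic as conjugacy *)

Lemma distinct_of_conjugate (p q x1 y1 x2 y2 : R) :
  0 < p -> 0 < q -> x1 ^ 2 + y1 ^ 2 = 1 -> conjugate p q x1 y1 x2 y2 ->
  (x1 - x2) ^ 2 + (y1 - y2) ^ 2 <> 0.
Proof.
  intros hp hq h1 hc h; unfold conjugate in hc.
  apply sum_squares_zero in h; destruct h as (hx & hy).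
  assert (ex : x2 = x1) by lra. assert (ey : y2 = y1) by lra. subst.
  assert (0 < q * x1 ^ 2 + p * y1 ^ 2) by (apply weighted_squares_pos; assumption).
  nra.
Qed.

Lemma tangent_at_iff (p q : R) (T X : point) :
  p <> 0 -> q <> 0 -> on_ellipse p q T ->
  (tangent_at p q T X <->
   fst T / p ^ 2 * fst X + snd T / q ^ 2 * snd X = 1).
Proof.
  intros hp hq hT; unfold on_ellipse, tangent_at in *.
  assert (e : fst T / p ^ 2 * fst T + snd T / q ^ 2 * snd T = 1).
  { rewrite <- hT; field; split; assumption. }
  split; intros h; lra.
Qed.

(** If [P = Q], the line reduces to one point, whereas the tangent at [T] contains a second one. *)
Lemma side_tangent_distinct (p q : R) (P Q : point) :
  p <> 0 -> q <> 0 -> side_tangent p q P Q -> P <> Q.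
Proof.
  intros hp hq (T & hT & hl) <-.
  assert (hP : forall X, line P P X -> X = P).
  { intros X (t & ->). destruct P as (x, y).
    unfold padd, pscal; cbn [fst snd]; f_equal; ring. }
  assert (hTP : T = P).
  { apply hP, hl. unfold tangent_at. ring. }
  (* This point is [T] moved by the gradient turned through a right angle. *)
  assert (hXP : (fst T + snd T / q ^ 2, snd T - fst T / p ^ 2) = P).
  { apply hP, hl. unfold tangent_at; cbn [fst snd]. ring. }
  rewrite hTP in hXP, hT. clear - hp hq hXP hT. destruct P as (x, y).
  unfold on_ellipse in hT; cbn [fst snd] in *.
  pose proof (f_equal fst hXP) as hx; pose proof (f_equal snd hXP) as hy.
  cbn [fst snd] in hx, hy.
  assert (hy0 : y / q ^ 2 = 0) by lra. assert (hx0 : x / p ^ 2 = 0) by lra.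
  apply Rdiv_eq_iff in hy0; [|apply pow_nonzero; assumption].
  apply Rdiv_eq_iff in hx0; [|apply pow_nonzero; assumption].
  rewrite Rmult_0_l in hx0, hy0. subst. lra.
Qed.

Lemma line_left (P Q : point) : line P Q P.
Proof.
  exists 0. destruct P, Q; unfold padd, pscal; cbn [fst snd]; f_equal; ring.
Qed.

Lemma line_right (P Q : point) : line P Q Q.
Proof.
  exists 1. destruct P, Q; unfold padd, pscal; cbn [fst snd]; f_equal; ring.
Qed.

(** In scaled coordinates the tangent is [m x + n y = 1] with [p^2 m^2 + q^2 n^2 = 1], the dual
    equation of the caustic; the chord formulas turn it into conjugacy. *)
Lemma conjugate_of_side_tangent (a b p q x1 y1 x2 y2 : R) :
  0 < a -> 0 < b -> 0 < p -> 0 < q -> p + q = 1 ->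
  x1 ^ 2 + y1 ^ 2 = 1 -> x2 ^ 2 + y2 ^ 2 = 1 ->
  side_tangent (a * p) (b * q) (a * x1, b * y1) (a * x2, b * y2) ->
  conjugate p q x1 y1 x2 y2.
Proof.
  intros ha hb hp hq hpq h1 h2 hst.
  assert (hap : a * p <> 0) by nra. assert (hbq : b * q <> 0) by nra.
  pose proof (side_tangent_distinct _ _ _ _ hap hbq hst) as hne.
  assert (hd : (x1 - x2) ^ 2 + (y1 - y2) ^ 2 <> 0).
  { intros h; apply hne. apply sum_squares_zero in h; destruct h.
    f_equal; f_equal; lra. }
  destruct hst as (T & hT & hl).
  set (m := fst T / (a * p ^ 2)). set (n := snd T / (b * q ^ 2)).
  assert (hmn : p ^ 2 * m ^ 2 + q ^ 2 * n ^ 2 = 1).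
  { rewrite <- hT. unfold m, n. field. repeat split; lra. }
  assert (hon : forall x y, line (a * x1, b * y1) (a * x2, b * y2) (a * x, b * y) ->
                m * x + n * y = 1).
  { intros x y hx. apply hl, tangent_at_iff in hx; trivial.
    rewrite <- hx; unfold m, n; cbn [fst snd]. field. repeat split; lra. }
  pose proof (hon x1 y1 (line_left _ _)) as e1.
  pose proof (hon x2 y2 (line_right _ _)) as e2.
  destruct (chord_of_unit_circle m n 1 x1 y1 x2 y2 h1 h2 hd e1 e2)
    as (_ & _ & hxx & hyy & _).
  assert (hN : m ^ 2 + n ^ 2 <> 0).
  { intros h; apply sum_squares_zero in h; destruct h as (hm & hn).
    rewrite hm, hn in e1; lra. }
  unfold conjugate. apply Rmult_eq_reg_l with (2 := hN).
  transitivity (q * ((m ^ 2 + n ^ 2) * (x1 * x2)) + p * ((m ^ 2 + n ^ 2) * (y1 * y2)));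
    [ring|].
  rewrite hxx, hyy. clear - hpq hmn. replace q with (1 - p) in * by lra. nsatz_pow.
Qed.

Lemma side_tangent_of_conjugate (a b p q x1 y1 x2 y2 : R) :
  0 < a -> 0 < b -> 0 < p -> 0 < q -> p + q = 1 ->
  x1 ^ 2 + y1 ^ 2 = 1 -> x2 ^ 2 + y2 ^ 2 = 1 ->
  conjugate p q x1 y1 x2 y2 ->
  side_tangent (a * p) (b * q) (a * x1, b * y1) (a * x2, b * y2).
Proof.
  intros ha hb hp hq hpq h1 h2 hc.
  pose proof (distinct_of_conjugate p q x1 y1 x2 y2 hp hq h1 hc) as hd.
  assert (hap : a * p <> 0) by nra. assert (hbq : b * q <> 0) by nra.
  unfold conjugate in hc.
  (* The chord is [(y2 - y1) x + (x1 - x2) y = w]; [hw2] is the dual equation of the caustic for it,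
     and [w <> 0] keeps it off the center. *)
  set (w := x1 * y2 - x2 * y1).
  assert (hw2 : p ^ 2 * (y2 - y1) ^ 2 + q ^ 2 * (x1 - x2) ^ 2 = w ^ 2).
  { unfold w; clear - hpq h1 h2 hc. replace q with (1 - p) in * by lra. nsatz_pow. }
  assert (hw : w <> 0).
  { intros h0; apply hd. rewrite h0 in hw2.
    replace (p ^ 2 * (y2 - y1) ^ 2 + q ^ 2 * (x1 - x2) ^ 2)
      with ((p * (y2 - y1)) ^ 2 + (q * (x1 - x2)) ^ 2) in hw2 by ring.
    rewrite pow_i in hw2 by auto with arith.
    apply sum_squares_zero in hw2; destruct hw2 as (hy & hx).
    apply Rmult_integral in hy, hx.
    destruct hy as [hy|hy]; [lra|]. destruct hx as [hx|hx]; [lra|].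
    rewrite hx. replace (y1 - y2) with 0 by lra. ring. }
  set (m := (y2 - y1) / w). set (n := (x1 - x2) / w).
  exists (a * p ^ 2 * m, b * q ^ 2 * n).
  assert (hT : on_ellipse (a * p) (b * q) (a * p ^ 2 * m, b * q ^ 2 * n)).
  { unfold on_ellipse; cbn [fst snd].
    transitivity ((p ^ 2 * (y2 - y1) ^ 2 + q ^ 2 * (x1 - x2) ^ 2) / w ^ 2).
    - unfold m, n; field; repeat split; lra.
    - rewrite hw2; field; exact hw. }
  split; [exact hT|]. intros X.
  rewrite (tangent_at_iff _ _ _ _ hap hbq hT); cbn [fst snd].
  assert (e : a * p ^ 2 * m / (a * p) ^ 2 * fst X + b * q ^ 2 * n / (b * q) ^ 2 * snd X
              = ((y2 - y1) * (fst X / a) + (x1 - x2) * (snd X / b)) / w).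
  { unfold m, n; field; repeat split; lra. }
  rewrite e, (Rdiv_eq_iff _ _ _ hw), Rmult_1_l; clear e.
  split.
  - intros (t & ->). unfold padd, pscal, w; cbn [fst snd]. field; split; lra.
  - destruct X as (x, y); cbn [fst snd]. intros hX.
    set (D := (x1 - x2) ^ 2 + (y1 - y2) ^ 2) in *.
    (* The parameter of the orthogonal projection onto the scaled chord. *)
    exists (((x1 - x / a) * (x1 - x2) + (y1 - y / b) * (y1 - y2)) / D).
    set (X := x / a) in *. set (Y := y / b) in *.
    assert (hx : x = a * X) by (unfold X; field; lra).
    assert (hy : y = b * Y) by (unfold Y; field; lra).
    rewrite hx, hy; unfold padd, pscal; cbn [fst snd]. clearbody X Y.
    assert (gx : D * (X - x1) = ((x1 - X) * (x1 - x2) + (y1 - Y) * (y1 - y2)) * (x2 - x1)).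
    { unfold D, w in *. clear - hX. nsatz_pow. }
    assert (gy : D * (Y - y1) = ((x1 - X) * (x1 - x2) + (y1 - Y) * (y1 - y2)) * (y2 - y1)).
    { unfold D, w in *. clear - hX. nsatz_pow. }
    set (k := (x1 - X) * (x1 - x2) + (y1 - Y) * (y1 - y2)) in *.
    assert (gx' : X = x1 + k / D * (x2 - x1)).
    { apply Rmult_eq_reg_l with (2 := hd).
      replace (D * (x1 + k / D * (x2 - x1))) with (D * x1 + k * (x2 - x1)) by (field; exact hd).
      rewrite <- gx; ring. }
    assert (gy' : Y = y1 + k / D * (y2 - y1)).
    { apply Rmult_eq_reg_l with (2 := hd).
      replace (D * (y1 + k / D * (y2 - y1))) with (D * y1 + k * (y2 - y1)) by (field; exact hd).
      rewrite <- gy; ring. }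
    f_equal; [rewrite gx' at 1 | rewrite gy' at 1]; ring.
Qed.

(** * The circumcenter of the unscaled triangle *)

Lemma collinear_det (P Q S : point) :
  collinear P Q S ->
  (fst P - fst Q) * (snd Q - snd S) - (snd P - snd Q) * (fst Q - fst S) = 0.
Proof.
  intros (A & B & _ & (r & ->) & (s & ->) & (t & ->)).
  unfold padd, pscal; cbn [fst snd]; ring.
Qed.

Lemma on_ellipse_scaled (a b x y : R) :
  a <> 0 -> b <> 0 -> (on_ellipse a b (a * x, b * y) <-> x ^ 2 + y ^ 2 = 1).
Proof.
  intros ha hb; unfold on_ellipse; cbn [fst snd].
  replace ((a * x) ^ 2 / a ^ 2 + (b * y) ^ 2 / b ^ 2) with (x ^ 2 + y ^ 2)
    by (field; split; assumption).
  reflexivity.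
Qed.

Lemma scaled_coordinates (a b : R) (P : point) :
  a <> 0 -> b <> 0 -> exists x y : R, P = (a * x, b * y).
Proof.
  intros ha hb; exists (fst P / a), (snd P / b).
  destruct P; cbn [fst snd]; f_equal; field; assumption.
Qed.

(** With [f = p - q], hence [1 - f = 2 q] and [1 + f = 2 p], this says that the claimed circumcenter
    lies on the bisector of the first side. *)
Lemma perpendicular_bisector_identity (f x1 y1 x2 y2 x3 y3 : R) :
  x1 ^ 2 + y1 ^ 2 = 1 -> x2 ^ 2 + y2 ^ 2 = 1 -> x3 ^ 2 + y3 ^ 2 = 1 ->
  x1 + x2 + x3 = - f * re3 x1 y1 x2 y2 x3 y3 ->
  y1 + y2 + y3 = - f * im3 x1 y1 x2 y2 x3 y3 ->
  (1 - f) * re3 x1 y1 x2 y2 x3 y3 * (x1 - x2)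
    + (1 + f) * im3 x1 y1 x2 y2 x3 y3 * (y1 - y2) = 2 * (x1 ^ 2 - x2 ^ 2).
Proof.
  intros h1 h2 h3 ex ey.
  transitivity ((re3 x1 y1 x2 y2 x3 y3 + (x1 + x2 + x3)) * (x1 - x2)
                + (im3 x1 y1 x2 y2 x3 y3 - (y1 + y2 + y3)) * (y1 - y2)).
  - rewrite ex, ey; ring.
  - unfold re3, im3. clear ex ey. nsatz_pow.
Qed.

Lemma pdist_eq_iff (O P Q : point) :
  pdist O P = pdist O Q <->
  2 * fst O * (fst P - fst Q) + 2 * snd O * (snd P - snd Q) =
  (fst P ^ 2 - fst Q ^ 2) + (snd P ^ 2 - snd Q ^ 2).
Proof.
  unfold pdist, dist_euc. split; intros h.
  - apply sqrt_inj in h; try (apply Rplus_le_le_0_compat; apply Rle_0_sqr).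
    unfold Rsqr in h; lra.
  - f_equal; unfold Rsqr; lra.
Qed.

Lemma is_circumcenter_iff (a b p q x1 y1 x2 y2 x3 y3 : R) (O : point) :
  0 < a -> 0 < b -> p + q = 1 ->
  x1 ^ 2 + y1 ^ 2 = 1 -> x2 ^ 2 + y2 ^ 2 = 1 -> x3 ^ 2 + y3 ^ 2 = 1 ->
  (x1 - x2) * (y2 - y3) - (y1 - y2) * (x2 - x3) <> 0 ->
  x1 + x2 + x3 = - (p - q) * re3 x1 y1 x2 y2 x3 y3 ->
  y1 + y2 + y3 = - (p - q) * im3 x1 y1 x2 y2 x3 y3 ->
  (is_circumcenter (a * x1, b * y1) (a * x2, b * y2) (a * x3, b * y3) O <->
   O = ((a ^ 2 - b ^ 2) * q / (2 * a) * re3 x1 y1 x2 y2 x3 y3,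
        (a ^ 2 - b ^ 2) * p / (2 * b) * im3 x1 y1 x2 y2 x3 y3)).
Proof.
  intros ha hb hpq h1 h2 h3 hdet ex ey.
  pose proof (perpendicular_bisector_identity _ _ _ _ _ _ _ h1 h2 h3 ex ey) as b12.
  assert (cyc_re : re3 x2 y2 x3 y3 x1 y1 = re3 x1 y1 x2 y2 x3 y3) by (unfold re3; ring).
  assert (cyc_im : im3 x2 y2 x3 y3 x1 y1 = im3 x1 y1 x2 y2 x3 y3) by (unfold im3; ring).
  assert (b23 := perpendicular_bisector_identity (p - q) x2 y2 x3 y3 x1 y1 h2 h3 h1
                   ltac:(rewrite cyc_re; lra) ltac:(rewrite cyc_im; lra)).
  rewrite cyc_re, cyc_im in b23.
  set (C := re3 x1 y1 x2 y2 x3 y3) in *. set (S := im3 x1 y1 x2 y2 x3 y3) in *.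
  clearbody C S. clear ex ey cyc_re cyc_im.
  destruct O as (X, Y). unfold is_circumcenter. rewrite !pdist_eq_iff; cbn [fst snd].
  set (X0 := (a ^ 2 - b ^ 2) * q / (2 * a) * C).
  set (Y0 := (a ^ 2 - b ^ 2) * p / (2 * b) * S).
  assert (hX0 : 2 * a * X0 = (a ^ 2 - b ^ 2) * q * C) by (unfold X0; field; lra).
  assert (hY0 : 2 * b * Y0 = (a ^ 2 - b ^ 2) * p * S) by (unfold Y0; field; lra).
  clearbody X0 Y0.
  assert (c12 : 2 * X0 * (a * x1 - a * x2) + 2 * Y0 * (b * y1 - b * y2) =
                ((a * x1) ^ 2 - (a * x2) ^ 2) + ((b * y1) ^ 2 - (b * y2) ^ 2)).
  { clear - hpq hX0 hY0 b12 h1 h2. replace q with (1 - p) in * by lra. nsatz_pow. }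
  assert (c23 : 2 * X0 * (a * x2 - a * x3) + 2 * Y0 * (b * y2 - b * y3) =
                ((a * x2) ^ 2 - (a * x3) ^ 2) + ((b * y2) ^ 2 - (b * y3) ^ 2)).
  { clear - hpq hX0 hY0 b23 h2 h3. replace q with (1 - p) in * by lra. nsatz_pow. }
  split.
  - intros (e12 & e23).
    (* Uniqueness: [(a (X - X0), b (Y - Y0))] is orthogonal to two independent scaled sides, hence
       zero. *)
    assert (d12 : a * (X - X0) * (x1 - x2) + b * (Y - Y0) * (y1 - y2) = 0) by lra.
    assert (d23 : a * (X - X0) * (x2 - x3) + b * (Y - Y0) * (y2 - y3) = 0) by lra.
    assert (eX : a * (X - X0) = 0).
    { apply Rmult_eq_reg_r with (2 := hdet). clear - d12 d23. nsatz_pow. }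
    assert (eY : b * (Y - Y0) = 0).
    { apply Rmult_eq_reg_r with (2 := hdet). clear - d12 d23. nsatz_pow. }
    apply Rmult_integral in eX, eY.
    destruct eX as [eX|eX], eY as [eY|eY]; try lra.
    f_equal; lra.
  - intros e; injection e as -> ->. split; assumption.
Qed.

(** * Size of the caustic *)

Lemma delta_sqr (a b : R) : 0 < b -> b < a ->
  delta a b ^ 2 = a ^ 4 - a ^ 2 * b ^ 2 + b ^ 4.
Proof. intros hb hab; unfold delta. apply pow2_sqrt. nra. Qed.

(** These bounds make both semi-axes of the caustic positive. *)
Lemma delta_bounds (a b : R) : 0 < b -> b < a -> b ^ 2 < delta a b < a ^ 2.
Proof.
  intros hb hab.
  pose proof (delta_sqr a b hb hab) as h.
  assert (h0 : 0 <= delta a b) by apply sqrt_pos.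
  assert (ha2 : 0 < a ^ 2) by nra. assert (hb2 : 0 < b ^ 2) by nra.
  assert (hab2 : 0 < a ^ 2 - b ^ 2) by nra.
  assert (k1 : delta a b ^ 2 = (b ^ 2) ^ 2 + a ^ 2 * (a ^ 2 - b ^ 2)) by (rewrite h; ring).
  assert (k2 : delta a b ^ 2 = (a ^ 2) ^ 2 - b ^ 2 * (a ^ 2 - b ^ 2)) by (rewrite h; ring).
  split; nra.
Qed.

(** * The locus as a parametrized ellipse *)

(* Semi-axes, up to sign, of the ellipse traced by [alpha X2 + beta X3]. *)
Definition locus_x (a b p q alpha beta : R) : R :=
  - alpha * a * (p - q) / 3 + beta * ((a ^ 2 - b ^ 2) * q / (2 * a)).
Definition locus_y (a b p q alpha beta : R) : R :=
  - alpha * b * (p - q) / 3 + beta * ((a ^ 2 - b ^ 2) * p / (2 * b)).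

Lemma locus_iff (a b p q alpha beta : R) (X : point) :
  0 < a -> 0 < b -> 0 < p -> 0 < q -> p + q = 1 ->
  caustic_a a b = a * p -> caustic_b a b = b * q ->
  (locus a b alpha beta X <->
   exists c s : R, c ^ 2 + s ^ 2 = 1 /\
     X = (locus_x a b p q alpha beta * c, locus_y a b p q alpha beta * s)).
Proof.
  intros ha hb hp hq hpq hca hcb.
  assert (ha0 : a <> 0) by lra. assert (hb0 : b <> 0) by lra.
  assert (value : forall x1 y1 x2 y2 x3 y3,
    x1 + x2 + x3 = - (p - q) * re3 x1 y1 x2 y2 x3 y3 ->
    y1 + y2 + y3 = - (p - q) * im3 x1 y1 x2 y2 x3 y3 ->
    padd (pscal alpha (centroid (a * x1, b * y1) (a * x2, b * y2) (a * x3, b * y3)))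
         (pscal beta
            ((a ^ 2 - b ^ 2) * q / (2 * a) * re3 x1 y1 x2 y2 x3 y3,
             (a ^ 2 - b ^ 2) * p / (2 * b) * im3 x1 y1 x2 y2 x3 y3)) =
    (locus_x a b p q alpha beta * re3 x1 y1 x2 y2 x3 y3,
     locus_y a b p q alpha beta * im3 x1 y1 x2 y2 x3 y3)).
  { intros x1 y1 x2 y2 x3 y3 ex ey.
    unfold centroid, padd, pscal; cbn [fst snd].
    replace (a * x1 + a * x2 + a * x3) with (a * (x1 + x2 + x3)) by ring.
    replace (b * y1 + b * y2 + b * y3) with (b * (y1 + y2 + y3)) by ring.
    rewrite ex, ey. unfold locus_x, locus_y.
    f_equal; field; assumption. }
  split.
  - intros (P & Q & S & O & (_ & hP & hQ & hS & hPQ & hQS & hSP) & hO & ->).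
    destruct (scaled_coordinates a b P ha0 hb0) as (x1 & y1 & ->).
    destruct (scaled_coordinates a b Q ha0 hb0) as (x2 & y2 & ->).
    destruct (scaled_coordinates a b S ha0 hb0) as (x3 & y3 & ->).
    apply on_ellipse_scaled in hP, hQ, hS; trivial.
    rewrite hca, hcb in hPQ, hQS, hSP.
    apply conjugate_of_side_tangent in hPQ, hQS, hSP; trivial.
    pose proof (distinct_of_conjugate p q x2 y2 x3 y3 hp hq hQ hQS) as hd.
    assert (hPS : conjugate p q x1 y1 x3 y3) by (unfold conjugate in *; lra).
    destruct (sum_of_conjugates p q x1 y1 x2 y2 x3 y3 hp hq hpq hP hQ hS hd hPQ hPS)
      as (ex & ey).
    pose proof (conjugates_not_aligned p q x1 y1 x2 y2 x3 y3 hp hq hP hd hPQ hPS) as hdet.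
    apply (is_circumcenter_iff a b p q) in hO; trivial. subst O.
    exists (re3 x1 y1 x2 y2 x3 y3), (im3 x1 y1 x2 y2 x3 y3).
    split; [apply re3_im3_unit|apply value]; assumption.
  - intros (c & s & hcs & ->).
    destruct (triangle_exists p q c s hp hq hpq hcs)
      as (x1 & y1 & x2 & y2 & x3 & y3 & h1 & h2 & h3 & hd & c12 & c13 & c23 & <- & <-).
    destruct (sum_of_conjugates p q x1 y1 x2 y2 x3 y3 hp hq hpq h1 h2 h3 hd c12 c13)
      as (ex & ey).
    pose proof (conjugates_not_aligned p q x1 y1 x2 y2 x3 y3 hp hq h1 hd c12 c13) as hdet.
    exists (a * x1, b * y1), (a * x2, b * y2), (a * x3, b * y3),
      ((a ^ 2 - b ^ 2) * q / (2 * a) * re3 x1 y1 x2 y2 x3 y3,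
       (a ^ 2 - b ^ 2) * p / (2 * b) * im3 x1 y1 x2 y2 x3 y3).
    split; [|split; [|symmetry; apply value; assumption]].
    + unfold poncelet_triangle; rewrite hca, hcb.
      split.
      { intros hcol; apply collinear_det in hcol; cbn [fst snd] in hcol; apply hdet.
        apply Rmult_eq_reg_l with (r := a * b); [|nra]. lra. }
      assert (c31 : conjugate p q x3 y3 x1 y1) by (unfold conjugate in *; lra).
      repeat split; try (apply on_ellipse_scaled; assumption);
        apply side_tangent_of_conjugate; assumption.
    + apply (is_circumcenter_iff a b p q); trivial.
Qed.

Lemma is_circle_of_param (L : point -> Prop) (A B : R) :
  A <> 0 -> A ^ 2 = B ^ 2 ->
  (forall X, L X <-> exists c s : R, c ^ 2 + s ^ 2 = 1 /\ X = (A * c, B * s)) ->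
  is_circle L.
Proof.
  intros hA hAB hL.
  assert (hB : B <> 0) by (intros ->; apply hA; nra).
  exists (0, 0), (Rabs A); split; [apply Rabs_pos_lt; exact hA|].
  intros X; rewrite hL; clear hL.
  unfold pdist, dist_euc; cbn [fst snd]; rewrite !Rminus_0_r.
  rewrite <- sqrt_Rsqr_abs.
  split.
  - intros (c & s & h & ->); cbn [fst snd]; f_equal; unfold Rsqr.
    transitivity (A ^ 2 * c ^ 2 + B ^ 2 * s ^ 2); [ring|].
    rewrite <- hAB, <- Rmult_plus_distr_l, h; ring.
  - intros h; apply sqrt_inj in h; [|apply Rplus_le_le_0_compat; apply Rle_0_sqr|apply Rle_0_sqr].
    destruct X as (x, y); cbn [fst snd] in h; unfold Rsqr in h.
    (* Dividing [y] by [B] absorbs the sign when [B = - A]. *)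
    exists (x / A), (y / B); split; [|f_equal; field; assumption].
    transitivity (x * x / A ^ 2 + y * y / B ^ 2); [field; split; assumption|].
    rewrite <- hAB.
    transitivity ((x * x + y * y) / A ^ 2); [field; assumption|].
    rewrite h; field; assumption.
Qed.

(** * The two ratios that give a circle *)

Theorem proposition4 (a b alpha beta : R)
  (Hb : 0 < b) (Hab : b < a) (Hbeta : beta <> 0)
  (Hratio :
     alpha / beta =
       (- (3 * a * b) + (delta a b + 2 * (a ^ 2 + b ^ 2))) / (2 * a * b) \/
     alpha / beta =
       (- (3 * a * b) - (delta a b + 2 * (a ^ 2 + b ^ 2))) / (2 * a * b)) :
  is_circle (locus a b alpha beta).
Proof.
  assert (ha : 0 < a) by lra.
  assert (hc : 0 < a ^ 2 - b ^ 2) by nra.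
  destruct (delta_bounds a b Hb Hab) as (hd1 & hd2).
  pose proof (delta_sqr a b Hb Hab) as hd.
  set (p := (delta a b - b ^ 2) / (a ^ 2 - b ^ 2)).
  set (q := (a ^ 2 - delta a b) / (a ^ 2 - b ^ 2)).
  assert (hp : 0 < p) by (apply Rdiv_lt_0_compat; lra).
  assert (hq : 0 < q) by (apply Rdiv_lt_0_compat; lra).
  assert (hpq : p + q = 1) by (unfold p, q; field; lra).
  assert (hca : caustic_a a b = a * p) by (unfold caustic_a, p; field; lra).
  assert (hcb : caustic_b a b = b * q) by (unfold caustic_b, q; field; lra).
  set (k := delta a b * (a ^ 2 + b ^ 2) - 2 * a ^ 2 * b ^ 2).
  (* [delta^2 - (a b)^2 = (a^2 - b^2)^2] gives [delta > a b]; combine this with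
     [a^2 + b^2 > 2 a b]. *)
  assert (hk : 0 < k).
  { assert (hdab : a * b < delta a b).
    { assert (0 < (a ^ 2 - b ^ 2) ^ 2) by nra. assert (0 < a * b) by nra.
      assert (0 < delta a b) by nra. nra. }
    assert (2 * (a * b) < a ^ 2 + b ^ 2) by nra. assert (0 < a * b) by nra.
    unfold k. nra. }
  (* The common factor of both semi-axes; [K <> 0] keeps the radius positive. *)
  set (K := beta * k / (2 * a * b * (a ^ 2 - b ^ 2))).
  assert (hK : K <> 0).
  { unfold K. apply Rmult_integral_contrapositive_currified.
    - apply Rmult_integral_contrapositive_currified; lra.
    - apply Rinv_neq_0_compat. assert (0 < a * b) by nra. nra. }
  assert (values :
    (locus_x a b p q alpha beta = (b - a) * K /\
     locus_y a b p q alpha beta = (a - b) * K) \/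
    (locus_x a b p q alpha beta = (a + b) * K /\
     locus_y a b p q alpha beta = (a + b) * K)).
  { set (d := delta a b) in *. clearbody d.
    destruct Hratio as [h|h]; [left|right];
      apply (Rdiv_eq_iff _ _ _ Hbeta) in h; subst alpha;
      unfold locus_x, locus_y, K, k, p, q; split; field_simplify_eq.
    all: try (repeat split; lra).
    (* With denominators cleared, these are polynomial identities modulo the equation for
       [d ^ 2]. *)
    all: clear - hd; nsatz_pow. }
  apply (is_circle_of_param _ (locus_x a b p q alpha beta) (locus_y a b p q alpha beta)).
  - destruct values as [(-> & _)|(-> & _)];
      apply Rmult_integral_contrapositive_currified; trivial; lra.
  - destruct values as [(-> & ->)|(-> & ->)]; ring.
  - intros X; apply locus_iff; assumption.
Qed.
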